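(* Let $A \in \mathbb{R}^{m\times n}$ ($m \ge n$) have full column rank with reduced QR decomposition $A = QR$, $Q^TQ = I_n$; let $\bm a_i$ and $\bm q_i$ denote the $i$-th rows of $A$ and $Q$ respectively (note $\sum_{i=1}^m\|\bm q_i\|_2^2 = n$). Let $l \ge n$ and form $A_1\in\mathbb{R}^{l\times n}$ as follows: independently for $s = 1,\dots,l$, choose an index $i_s \in\{1,\dots,m\}$ with $\mathbb{P}[i_s = k] = \|\bm q_k\|_2^2/n$, and let the $s$-th row of $A_1$ be $\|\bm q_{i_s}\|_2^{-1}\bm a_{i_s}$. When $A_1$ has full column rank let $R_1$ be the upper triangular factor (positive diagonal) of a reduced QR decomposition of $A_1$ and $X := AR_1^{-1}$; when $A_1$ is rank deficient set $\operatorname{cond}(X) := +\infty$. Then for every $\delta>0$ and $\varepsilon\in(0,1)$, $$\mathbb{P}\left[\operatorname{cond}(X) \ge \sqrt{\frac{1+\delta}{1-\varepsilon}}\right] \le n\left[\left(\frac{e^{-\varepsilon}}{(1-\varepsilon)^{1-\varepsilon}}\right)^{l/n} + \left(\frac{e^{\delta}}{(1+\delta)^{1+\delta}}\right)^{l/n}\right].$$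
   Context: For a full column rank matrix $M$, $\operatorname{cond}(M) = \sigma_{\max}(M)/\sigma_{\min}(M)$, the ratio of its largest and smallest (i.e. $n$-th) singular values. *)

(* Defs.v *)
From HB Require Import structures.
From mathcomp Require Import all_boot all_order all_algebra.
From mathcomp Require Import classical_sets boolp reals ereal.
From mathcomp.analysis Require Import sequences exp.
Set Implicit Arguments. Unset Strict Implicit. Unset Printing Implicit Defensive.
Import Order.TTheory GRing.Theory Num.Theory.
Local Open Scope ring_scope.
Local Open Scope classical_set_scope.

Section Defs.
Variable R : realType.

Definition vnorm2 (k : nat) (v : 'cV[R]_k) : R :=
  Num.sqrt (\sum_(i < k) v i 0 ^+ 2).

Definition rownorm2 (m n : nat) (M : 'M[R]_(m, n)) (i : 'I_m) : R :=
  Num.sqrt (\sum_(j < n) M i j ^+ 2).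

Definition sigma_max (m n : nat) (M : 'M[R]_(m, n)) : R :=
  sup [set vnorm2 (M *m v) | v in [set v : 'cV[R]_n | vnorm2 v = 1]].

Definition sigma_min (m n : nat) (M : 'M[R]_(m, n)) : R :=
  inf [set vnorm2 (M *m v) | v in [set v : 'cV[R]_n | vnorm2 v = 1]].

Definition upper_triangular (n : nat) (T : 'M[R]_n) : Prop :=
  forall i j : 'I_n, (j < i)%N -> T i j = 0.

Definition is_reduced_QR (l n : nat) (A1 Q1 : 'M[R]_(l, n)) (R1 : 'M[R]_n) : Prop :=
  [/\ A1 = Q1 *m R1, Q1^T *m Q1 = 1%:M, upper_triangular R1 &
      forall i : 'I_n, 0 < R1 i i].

(* the R factor of the reduced QR decomposition (unique when A1 has full column rank) *)
Definition qr_R (l n : nat) (A1 : 'M[R]_(l, n)) : 'M[R]_n :=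
  xget 0 [set R1 | exists Q1, is_reduced_QR A1 Q1 R1].

Definition sketch (m n l : nat) (A Q : 'M[R]_(m, n)) (idx : {ffun 'I_l -> 'I_m})
  : 'M[R]_(l, n) :=
  \matrix_(s < l, j < n) ((rownorm2 Q (idx s))^-1 * A (idx s) j).

Definition cond_X (m n l : nat) (A Q : 'M[R]_(m, n)) (idx : {ffun 'I_l -> 'I_m})
  : \bar R :=
  let A1 := sketch A Q idx in
  if \rank A1 == n then
    let X := A *m invmx (qr_R A1) in ((sigma_max X / sigma_min X)%:E)%E
  else (+oo)%E.

Definition lev_prob (m n : nat) (Q : 'M[R]_(m, n)) (k : 'I_m) : R :=
  rownorm2 Q k ^+ 2 / n%:R.

Definition prob_idx (m n l : nat) (Q : 'M[R]_(m, n))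
  (E : {ffun 'I_l -> 'I_m} -> Prop) : R :=
  \sum_(idx : {ffun 'I_l -> 'I_m} | `[< E idx >]) \prod_(s < l) lev_prob Q (idx s).

End Defs.

(* Main.v *)
(* The Gram matrix of the sketch of [Q] is [Y = \sum_s u_s u_s^T], where the [u_s] are
   independent unit vectors with [E (u u^T) = I / n], and the singular values of [X] are
   the inverse square roots of the eigenvalues of [Y].  Their tails are bounded by a
   matrix Chernoff argument with the potentials [tr (I + c Y)^M] and
   [tr ((1 + c l) I - c Y)^M], where [c] is of order [1 / M] and [M] tends to infinity;
   both matrices stay above the identity.  The usual appeal to Golden-Thompson or Lieb
   is replaced by an elementary estimate for rank-one updates [B = K + c u u^T] with
   [K >= I]: the mixed moments [b j i = u^T K^j B^i u] satisfy
   [b j i.+1 = b j.+1 i + c * (b j 0 * b 0 i)] and log-convexity gives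
   [b j 0 * b 0 i <= b j i <= b j.+1 i], so
   [b j.+1 i <= b j i.+1 <= (1 + c) * b j.+1 i], while
   [tr B^M - tr K^M = c * \sum_(i < M) b (M - 1 - i) i] telescopes. *)
Require Import Defs.
From HB Require Import structures.
From mathcomp Require Import all_boot all_order all_algebra.
From mathcomp Require Import zify ring lra.
From mathcomp Require Import classical_sets boolp reals ereal.
From mathcomp Require Import topology normedtype.
From mathcomp.analysis Require Import sequences exp.
Import Order.TTheory GRing.Theory Num.Theory.
Local Open Scope ring_scope.
Set Implicit Arguments. Unset Strict Implicit. Unset Printing Implicit Defensive.

(** * Log-convex sequences starting at 1 *)

Section LogConvex.
Variables (R : realFieldType) (h : nat -> R).
Hypotheses (h0 : h 0%N = 1) (h1 : 1 <= h 1%N).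
Hypothesis h_logconvex : forall g, h g.+1 ^+ 2 <= h g * h g.+2.

Lemma logconvex_gt0 g : 0 < h g.
Proof.
suff [] : 0 < h g /\ 0 < h g.+1 by [].
elim: g => [|g [hg hg1]]; first by rewrite h0; split=> //; apply: lt_le_trans h1.
split=> //; rewrite -(pmulr_rgt0 _ hg).
by apply: lt_le_trans (h_logconvex g); rewrite exprn_gt0.
Qed.

(** Log-convexity makes the ratio [h g.+1 / h g] nondecreasing; this compares the ratios at [p] and
    [p + q] after clearing denominators. *)
Lemma logconvex_shift p q : h p.+1 * h (p + q)%N <= h p * h (p + q).+1.
Proof.
elim: q => [|q IH]; first by rewrite addn0 mulrC.
rewrite addnS -(ler_pM2r (logconvex_gt0 (p + q))).
have := h_logconvex (p + q); have := logconvex_gt0 p.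
have := logconvex_gt0 (p + q).+1.
move: (h (p + q)) (h (p + q).+1) (h (p + q).+2) (h p) (h p.+1) IH => a b d e f.
nra.
Qed.

(** Moving one unit of index from the smaller argument to the larger only increases the product;
    repeating this ends at [h 0 * h (p + q)], where [h 0 = 1]. *)
Lemma logconvex_supermul p q : h p * h q <= h (p + q)%N.
Proof.
wlog pq : p q / (p <= q)%N.
  by move=> H; have [/H//|/ltnW/H] := leqP p q; rewrite mulrC addnC.
elim: p q pq => [|p IH] q pq; first by rewrite h0 mul1r.
rewrite addSnnS; apply: le_trans (IH _ (leqW (ltnW pq))).
by have := logconvex_shift p (q - p); rewrite subnKC // ltnW.
Qed.

Lemma logconvex_le g : h g <= h g.+1.
Proof.
have := logconvex_supermul g 1; rewrite addn1; apply: le_trans.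
by rewrite ler_peMr // ltW // logconvex_gt0.
Qed.

Lemma logconvex_expr g : h 1%N ^+ g <= h g.
Proof.
elim: g => [|g IH]; first by rewrite h0 expr0.
have := logconvex_supermul 1 g; rewrite add1n exprS; apply: le_trans.
by rewrite ler_wpM2l // (le_trans ler01 h1).
Qed.
End LogConvex.

(** * Mixed moments of a matrix and its rank-one update *)

(* In the application [b j i = u^T S^j (S + c u u^T)^i u]. *)
Section MixedMoments.
Variables (R : realFieldType) (b : nat -> nat -> R) (c : R).
Hypotheses (c_gt0 : 0 < c) (b0_ge0 : forall i, 0 <= b 0%N i).
Hypothesis b_rec : forall j i, b j i.+1 = b j.+1 i + c * (b j 0%N * b 0%N i).
Hypothesis b_supermul : forall p q, b p 0%N * b q 0%N <= b (p + q)%N 0%N.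
Hypothesis b_incr : forall g, b g 0%N <= b g.+1 0%N.

(** Under [b_rec] both sides split alike: the shifted moments compare by induction at [k.+1], the
    rank-one terms by [b_supermul] times [b 0 i >= 0]. *)
Lemma mixed_supermul j k i : b j 0%N * b k i <= b (j + k)%N i.
Proof.
elim: i k => [|i IH] k; first exact: b_supermul.
rewrite !b_rec mulrDr -addnS lerD // mulrCA ler_pM2l // mulrA.
by rewrite ler_wpM2r.
Qed.

Lemma mixed_incr j i : b j i <= b j.+1 i.
Proof.
elim: i j => [|i IH] j; first exact: b_incr.
by rewrite !b_rec lerD // ler_pM2l // ler_wpM2r.
Qed.

Lemma mixed_step j i : b j i.+1 <= (1 + c) * b j.+1 i.
Proof.
rewrite b_rec mulrDl mul1r lerD2l ler_pM2l //.
apply: le_trans (mixed_incr _ _).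
by have := mixed_supermul j 0 i; rewrite addn0.
Qed.

Lemma mixed_le_left j i : b j i <= (1 + c) ^+ i * b (j + i)%N 0%N.
Proof.
elim: i j => [|i IH] j; first by rewrite expr0 mul1r addn0.
apply: le_trans (mixed_step _ _) _.
by rewrite exprS -mulrA ler_pM2l ?addr_gt0// -addSnnS.
Qed.

Lemma mixed_ge_right j i : (1 + c)^-1 ^+ j * b 0%N (j + i)%N <= b j i.
Proof.
elim: j i => [|j IH] i; first by rewrite expr0 mul1r.
rewrite exprS addSnnS -mulrA ler_pdivrMl ?addr_gt0//.
by apply: le_trans (IH _) (mixed_step _ _).
Qed.

(** Trading the [i] updated factors for original ones costs at most [(1 + c) ^+ i], and [c] times
    the geometric sum of ratio [1 + c] telescopes. *)
Lemma sum_mixed_le N :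
  c * (\sum_(i < N.+1) b (N - i)%N i) <= ((1 + c) ^+ N.+1 - 1) * b N 0%N.
Proof.
rewrite subrX1 addrAC subrr add0r -mulrA ler_pM2l // mulr_suml.
apply: ler_sum => i _; have := mixed_le_left (N - i) i.
by rewrite subnK // -ltnS.
Qed.

Lemma sum_mixed_ge N :
  (1 - (1 + c)^-1 ^+ N.+1) * b 0%N N <= c * (\sum_(i < N.+1) b (N - i)%N i).
Proof.
have c1 : 0 < 1 + c by rewrite addr_gt0.
set w := (1 + c)^-1.
have wE : 1 - w = c * w by rewrite /w; field; rewrite lt0r_neq0.
have w1 : w <= 1 by rewrite invf_le1 // lerDl ltW.
rewrite -opprB subrX1 -mulNr opprB wE -!mulrA ler_pM2l //.
(* The surplus factor [w <= 1] coming from [1 - w = c * w] is discarded. *)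
apply: le_trans (_ : (\sum_(i < N.+1) w ^+ i) * b 0%N N <= _).
  by rewrite ler_piMl // mulr_ge0 // sumr_ge0 // => i _; rewrite exprn_ge0 // invr_ge0 ltW.
rewrite (reindex_inj rev_ord_inj) /= mulr_suml.
apply: ler_sum => i _; have := mixed_ge_right (N - i) i.
by rewrite subSS subnK // -ltnS.
Qed.
End MixedMoments.

(** * Quadratic forms, Cauchy-Schwarz and moments of matrix powers *)

Section QuadraticForms.
Variables (R : realFieldType) (n : nat).
Implicit Types (M K : 'M[R]_n) (u x y : 'cV[R]_n).

Definition bform M x y : R := (x^T *m M *m y) 0 0.
Definition qform M x : R := bform M x x.

Lemma bformC M x y : bform M^T x y = bform M y x.
Proof.
rewrite /bform.
have -> : x^T *m M^T *m y = (y^T *m M *m x)^T by rewrite !trmx_mul trmxK mulmxA.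
by rewrite mxE.
Qed.

Lemma bform_mul M (P P' : 'M[R]_n) x y :
  bform M (P *m x) (P' *m y) = bform (P^T *m M *m P') x y.
Proof. by rewrite /bform trmx_mul !mulmxA. Qed.

Lemma qformD M M' x : qform (M + M') x = qform M x + qform M' x.
Proof. by rewrite /qform /bform mulmxDr mulmxDl mxE. Qed.

Lemma qformZ a M x : qform (a *: M) x = a * qform M x.
Proof. by rewrite /qform /bform -scalemxAr -scalemxAl mxE. Qed.

Lemma qform_tr M x : qform M^T x = qform M x.
Proof. exact: bformC. Qed.

Lemma qform_sum (I : finType) (F : I -> 'M[R]_n) x :
  qform (\sum_i F i) x = \sum_i qform (F i) x.
Proof. by rewrite /qform /bform mulmx_sumr mulmx_suml summxE. Qed.

Lemma qform1E x : qform 1%:M x = \sum_i x i 0 ^+ 2.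
Proof.
by rewrite /qform /bform mulmx1 mxE; apply: eq_bigr => i _; rewrite mxE -expr2.
Qed.

Lemma qform1_ge0 x : 0 <= qform 1%:M x.
Proof. by rewrite qform1E sumr_ge0 // => i _; rewrite sqr_ge0. Qed.

Lemma qform1Z a x : qform 1%:M (a *: x) = a ^+ 2 * qform 1%:M x.
Proof. by rewrite !qform1E mulr_sumr; apply: eq_bigr => i _; rewrite mxE exprMn. Qed.

Lemma qform_dyad M M' u :
  qform (M *m (u *m u^T) *m M') u = qform M u * qform M' u.
Proof.
rewrite /qform /bform.
have -> : u^T *m (M *m (u *m u^T) *m M') *m u = (u^T *m M *m u) *m (u^T *m M' *m u).
  by rewrite !mulmxA.
by rewrite mxE big_ord1.
Qed.

Lemma qform_outer u x : qform (u *m u^T) x = (u^T *m x) 0 0 ^+ 2.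
Proof.
rewrite /qform /bform.
have -> : x^T *m (u *m u^T) *m x = (u^T *m x)^T *m (u^T *m x).
  by rewrite trmx_mul trmxK !mulmxA.
by rewrite mxE big_ord1 mxE expr2.
Qed.

Lemma mxtrace_dyad M u : \tr (M *m (u *m u^T)) = qform M u.
Proof. by rewrite mulmxA mxtrace_mulC mulmxA /mxtrace big_ord1. Qed.

Lemma bform_CauchySchwarz M x y : M^T = M -> (forall z, 0 <= qform M z) ->
  bform M x y ^+ 2 <= qform M x * qform M y.
Proof.
move=> Msym Mpos.
have E t : qform M (x + t *: y) = qform M x + 2 * t * bform M x y + t ^+ 2 * qform M y.
  rewrite /qform.
  have -> : bform M (x + t *: y) (x + t *: y)
    = bform M x x + t * bform M x y + t * bform M y x + t ^+ 2 * bform M y y.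
    rewrite /bform [(x + _)^T]linearD /= [(t *: y)^T]linearZ /=.
    rewrite !(mulmxDl, mulmxDr) -!scalemxAl -!scalemxAr.
    by rewrite scalerA !mxE; ring.
  by rewrite -[in bform M y x]Msym bformC; ring.
have := Mpos y; rewrite le_eqVlt => /orP[/eqP y0|y0].
  have [->|B0] := eqVneq (bform M x y) 0; first by rewrite -y0 mulr0 expr0n.
  (* With [qform M y = 0] the form is affine along [y]; this multiple of [y] would give it the value
     -1. *)
  have := Mpos (x + (- (qform M x + 1) / (2 * bform M x y)) *: y).
  rewrite E -y0 mulr0 addr0.
  have -> : 2 * (- (qform M x + 1) / (2 * bform M x y)) * bform M x y = - (qform M x + 1).
    by field.
  lra.
(* The minimiser of the quadratic polynomial [E] in [t]. *)
have := Mpos (x + (- bform M x y / qform M y) *: y); rewrite E.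
have -> : qform M x + 2 * (- bform M x y / qform M y) * bform M x y
   + (- bform M x y / qform M y) ^+ 2 * qform M y
   = (qform M x * qform M y - bform M x y ^+ 2) / qform M y.
  by field; rewrite lt0r_neq0.
by rewrite pmulr_lge0 ?invr_gt0// subr_ge0.
Qed.

Lemma trmxX M k : M^T = M -> (M ^+ k)^T = M ^+ k.
Proof.
move=> MT; elim: k => [|k IH]; first by rewrite expr0 trmx1.
by rewrite {1}exprS [LHS]trmx_mul IH MT exprSr.
Qed.

(** The Loewner order [K >= I]. On a unit vector it puts the first moment above the zeroth, so that
    log-convex moments are nondecreasing. *)
Definition ge_id K := K^T = K /\ forall x, qform 1%:M x <= qform K x.

(** Write [g = 2 a + e] with [e] the parity of [g]. Cauchy-Schwarz for the form [K ^+ e] at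
    [K ^+ a *m u] and [K ^+ a.+1 *m u] gives the claim, so only positivity of [I] and [K] enters. *)
Lemma ge_id_expr_logconvex K u : ge_id K ->
  forall g, qform (K ^+ g.+1) u ^+ 2 <= qform (K ^+ g) u * qform (K ^+ g.+2) u.
Proof.
move=> [KT K1] g; rewrite -[g](odd_double_half g).
set a := g./2; set e : nat := odd g.
have E i j : bform (K ^+ e) (K ^+ i *m u) (K ^+ j *m u) = qform (K ^+ (i + e + j)) u.
  by rewrite bform_mul trmxX // !exprD.
have := @bform_CauchySchwarz (K ^+ e) (K ^+ a *m u) (K ^+ a.+1 *m u) (trmxX e KT).
rewrite /qform !E /qform -addnn.
have -> : (a + e + a.+1 = (e + (a + a)).+1)%N by lia.
have -> : (a.+1 + e + a.+1 = (e + (a + a)).+2)%N by lia.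
have -> : (a + e + a = e + (a + a))%N by lia.
apply=> z; rewrite /e; case: (odd g); last by rewrite expr0 qform1_ge0.
by rewrite expr1; apply: le_trans (K1 z); rewrite qform1_ge0.
Qed.

Lemma ge_id_dyad K c u : 0 <= c -> ge_id K -> ge_id (K + c *: (u *m u^T)).
Proof.
move=> c0 [KT K1]; split.
  by rewrite [LHS]linearD /= [(c *: _)^T]linearZ /= trmx_mul trmxK KT.
move=> x; rewrite qformD qformZ; apply: le_trans (K1 x) _.
by rewrite lerDl mulr_ge0 // qform_outer sqr_ge0.
Qed.

End QuadraticForms.

(** * Trace of a power under a rank-one update *)

Section RankOneUpdate.
Variables (R : realFieldType) (n : nat) (K : 'M[R]_n) (u : 'cV[R]_n).
Hypotheses (K_ge1 : ge_id K) (u_unit : qform 1%:M u = 1).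

Let h g := qform (K ^+ g) u.

Let h0 : h 0%N = 1.
Proof. by rewrite /h expr0. Qed.

Let h1 : 1 <= h 1%N.
Proof. by rewrite /h expr1 -u_unit; case: K_ge1. Qed.

Let h_logconvex := ge_id_expr_logconvex u K_ge1.

Lemma qform_expr_gt0 g : 0 < qform (K ^+ g) u.
Proof. exact: logconvex_gt0 h0 h1 h_logconvex g. Qed.

Lemma qform_expr_le g : qform (K ^+ g) u <= qform (K ^+ g.+1) u.
Proof. exact: logconvex_le h0 h1 h_logconvex g. Qed.

Lemma qform_expr_ge g : qform K u ^+ g <= qform (K ^+ g) u.
Proof. by have := logconvex_expr h0 h1 h_logconvex g; rewrite {1}/h expr1. Qed.

(** By log-convexity the ratio of consecutive moments is at most the next ratio; there the odd power
    is [K] between two copies of [K ^+ p.+1], so [K <= beta] applies to [K ^+ p.+1 *m u]. *)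
Lemma qform_expr_upper beta p : (forall x, qform K x <= beta * qform 1%:M x) ->
  qform (K ^+ p.*2.+2) u <= beta * qform (K ^+ p.*2.+1) u.
Proof.
move=> Kb; rewrite -(ler_pM2r (qform_expr_gt0 p.*2.+2)) -expr2.
apply: le_trans (h_logconvex p.*2.+1) _; rewrite mulrAC mulrC ler_pM2r ?qform_expr_gt0//.
have -> : K ^+ p.*2.+3 = (K ^+ p.+1)^T *m K *m K ^+ p.+1.
  rewrite trmxX; last by case: K_ge1.
  by rewrite -[RHS]/(K ^+ p.+1 * K * K ^+ p.+1) -exprSr -exprD; congr (_ ^+ _); lia.
have -> : K ^+ p.*2.+2 = (K ^+ p.+1)^T *m 1%:M *m K ^+ p.+1.
  rewrite trmxX; last by case: K_ge1.
  by rewrite mulmx1 -[RHS]/(K ^+ p.+1 * K ^+ p.+1) -exprD; congr (_ ^+ _); lia.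
by rewrite /qform -!bform_mul; apply: Kb.
Qed.

Variable c : R.
Hypothesis c_gt0 : 0 < c.
Let B := K + c *: (u *m u^T).
Let b j i := qform (K ^+ j * B ^+ i) u.

Let B_ge1 : ge_id B. Proof. exact: ge_id_dyad (ltW c_gt0) K_ge1. Qed.

Let bE0 j : b j 0 = h j.
Proof. by rewrite /b expr0 mulr1. Qed.

Let b0E i : b 0 i = qform (B ^+ i) u.
Proof. by rewrite /b expr0 mul1r. Qed.

Let b0_ge0 i : 0 <= b 0 i.
Proof.
rewrite b0E; have h'0 : qform (B ^+ 0) u = 1 by rewrite expr0.
have h'1 : 1 <= qform (B ^+ 1) u by rewrite expr1 -u_unit; case: B_ge1.
exact: ltW (logconvex_gt0 h'0 h'1 (ge_id_expr_logconvex u B_ge1) i).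
Qed.

Let expr_update j i :
  K ^+ j * B ^+ i.+1 = K ^+ j.+1 * B ^+ i + c *: (K ^+ j *m (u *m u^T) *m B ^+ i).
Proof.
have KB : K ^+ j * B = K ^+ j.+1 + c *: (K ^+ j *m (u *m u^T)).
  by rewrite /B mulrDr -exprSr; congr (_ + _); exact/esym/scalemxAr.
by rewrite [B ^+ i.+1]exprS mulrA KB mulrDl; congr (_ + _); exact/esym/scalemxAl.
Qed.

Let b_rec j i : b j i.+1 = b j.+1 i + c * (b j 0 * b 0 i).
Proof.
by rewrite bE0 b0E /b expr_update qformD qformZ qform_dyad.
Qed.

Let b_supermul p q : b p 0 * b q 0 <= b (p + q)%N 0.
Proof. by rewrite !bE0; exact: logconvex_supermul h0 h1 h_logconvex p q. Qed.

Let b_incr g : b g 0 <= b g.+1 0.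
Proof. by rewrite !bE0; exact: qform_expr_le. Qed.


Let trace_update N :
  \tr (B ^+ N.+1) - \tr (K ^+ N.+1) = c * \sum_(i < N.+1) b (N - i)%N i.
Proof.
pose f i := \tr (K ^+ (N.+1 - i) * B ^+ i).
have -> : \tr (B ^+ N.+1) - \tr (K ^+ N.+1) = f N.+1 - f 0%N.
  by rewrite /f subnn subn0 !expr0 mul1r mulr1.
rewrite -(@telescope_sumr _ 0 N.+1) // big_mkord mulr_sumr.
apply: eq_bigr => i _; have iN : (i <= N)%N by rewrite -ltnS.
rewrite /f subSS subSn // expr_update mxtraceD addrC addKr mxtraceZ; congr (_ * _).
(* Cyclicity yields the moment with [B ^+ i] on the left; transposition restores the order used in
   [b]. *)
rewrite mxtrace_mulC (mulmxA (B ^+ i)) mxtrace_dyad -qform_tr trmx_mul.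
by case: K_ge1 B_ge1 => [KT _] [BT _]; rewrite !trmxX.
Qed.

(** The telescoped sum is bounded by a moment of order [N], which is then raised to order [N.+1] so
    that averaging over isotropic [u] reproduces the trace potential. *)
Lemma trace_update_le N :
  \tr (B ^+ N.+1) <= \tr (K ^+ N.+1) + ((1 + c) ^+ N.+1 - 1) * qform (K ^+ N.+1) u.
Proof.
rewrite -lerBlDl trace_update.
apply: le_trans (sum_mixed_le c_gt0 b0_ge0 b_rec b_supermul b_incr N) _.
rewrite bE0 ler_wpM2l ?qform_expr_le// subr_ge0 exprn_ege1 //.
by rewrite lerDl ltW.
Qed.

Lemma trace_update_ge N :
  \tr (K ^+ N.+1) <= \tr (B ^+ N.+1) - (1 - (1 + c)^-1 ^+ N.+1) * qform (B ^+ N) u.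
Proof.
rewrite lerBrDr -lerBrDl trace_update -b0E.
exact: sum_mixed_ge c_gt0 b0_ge0 b_rec b_supermul b_incr N.
Qed.

End RankOneUpdate.

(** With [M = K ^+ p], the trace is the sum of the squared row norms of [M], and by Cauchy-Schwarz
    each of them dominates the square of one coordinate of [M *m v]. *)
Lemma qform_le_trace (R : realFieldType) (n : nat) (K : 'M[R]_n) (v : 'cV[R]_n) p :
  K^T = K -> qform 1%:M v = 1 -> qform (K ^+ p.*2) v <= \tr (K ^+ p.*2).
Proof.
move=> KT v1; set M := K ^+ p.
have -> : K ^+ p.*2 = M^T *m M.
  by rewrite trmxX // -[RHS]/(M * M) -exprD addnn.
have -> : qform (M^T *m M) v = qform 1%:M (M *m v).
  by rewrite /qform bform_mul mulmx1.
rewrite qform1E mxtrace_mulC /mxtrace; apply: ler_sum => i _.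
have := bform_CauchySchwarz (row i M)^T v (trmx1 _ _) (@qform1_ge0 R n).
rewrite v1 mulr1; congr (_ <= _).
  rewrite /bform trmxK mulmx1; congr (_ ^+ 2).
  by rewrite -row_mul mxE.
rewrite qform1E mxE; apply: eq_bigr => j _.
by rewrite !mxE expr2.
Qed.

(** * Expectations over independent samples *)

Section ProductExpectation.
Variables (R : realFieldType) (T : finType) (p : T -> R).

Definition prod_expect l (G : {ffun 'I_l -> T} -> R) : R :=
  \sum_(f : {ffun 'I_l -> T}) (\prod_(s < l) p (f s)) * G f.

Definition ffun_cons l (k : T) (f : {ffun 'I_l -> T}) : {ffun 'I_l.+1 -> T} :=
  [ffun i => oapp f k (unlift ord0 i)].

Lemma ffun_cons0 l k (f : {ffun 'I_l -> T}) : ffun_cons k f ord0 = k.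
Proof. by rewrite ffunE unlift_none. Qed.

Lemma ffun_consS l k (f : {ffun 'I_l -> T}) s : ffun_cons k f (lift ord0 s) = f s.
Proof. by rewrite ffunE liftK. Qed.

Lemma sum_ffun_cons l (G : {ffun 'I_l.+1 -> T} -> R) :
  \sum_f G f = \sum_(f : {ffun 'I_l -> T}) \sum_k G (ffun_cons k f).
Proof.
rewrite pair_big /= (reindex (fun kf : {ffun 'I_l -> T} * T => ffun_cons kf.2 kf.1)) //.
exists (fun f : {ffun 'I_l.+1 -> T} => ([ffun s => f (lift ord0 s)], f ord0)).
  move=> [f k] _ /=; rewrite ffun_cons0; congr (_, _).
  by apply/ffunP => s; rewrite ffunE ffun_consS.
move=> f _; apply/ffunP => i /=.
case: (unliftP ord0 i) => [j ->|->]; last by rewrite ffun_cons0.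
by rewrite ffun_consS ffunE.
Qed.

Hypothesis p_ge0 : forall k, 0 <= p k.

(** Conditioning on all samples but the first, each sample costs a factor [r]. The horizon [L]
    limits the hypothesis to sums of fewer than [L] terms, as the lower-tail potential is controlled
    only up to [l] dyads. *)
Lemma prod_expect_sum_le (V : zmodType) (X : T -> V) (Phi : V -> R) (r : R) (L : nat) :
  0 <= r ->
  (forall j (f : {ffun 'I_j -> T}), (j < L)%N ->
     \sum_k p k * Phi (\sum_s X (f s) + X k) <= r * Phi (\sum_s X (f s))) ->
  forall l, (l <= L)%N ->
  prod_expect (fun f : {ffun 'I_l -> T} => Phi (\sum_s X (f s))) <= r ^+ l * Phi 0.
Proof.
move=> r0 step; elim=> [|l IH] lL.
  pose f0 : {ffun 'I_0 -> T} :=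
    [ffun s : 'I_0 => match s with Ordinal _ H => False_rect T (notF H) end].
  rewrite /prod_expect (big_pred1 f0).
    by rewrite !big_ord0.
  by move=> f /=; apply/esym/eqP/ffunP => -[].
rewrite exprS -mulrA; apply: le_trans (ler_wpM2l r0 (IH (ltnW lL))).
rewrite /prod_expect sum_ffun_cons mulr_sumr; apply: ler_sum => f _.
rewrite mulrCA.
apply: le_trans (ler_wpM2l _ (step l f lL)); last by rewrite prodr_ge0.
rewrite mulr_sumr; apply: ler_sum => k _.
have -> : \prod_(s < l.+1) p (ffun_cons k f s) = p k * \prod_(s < l) p (f s).
  by rewrite big_ord_recl ffun_cons0; under eq_bigr do rewrite ffun_consS.
have -> : \sum_(s < l.+1) X (ffun_cons k f s) = \sum_(s < l) X (f s) + X k.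
  by rewrite big_ord_recl ffun_cons0 addrC; under eq_bigr do rewrite ffun_consS.
by rewrite mulrCA mulrA.
Qed.

Lemma prod_expectZ l a (G : {ffun 'I_l -> T} -> R) :
  prod_expect (fun f => G f * a) = prod_expect G * a.
Proof. by rewrite mulr_suml; apply: eq_bigr => f _; rewrite mulrA. Qed.

End ProductExpectation.

(** * Trace potentials of sums of random isotropic dyads *)

Section IsotropicDyads.
Variables (R : realFieldType) (T : finType) (p : T -> R) (n : nat) (u : T -> 'cV[R]_n).
Hypotheses (n_gt0 : (0 < n)%N) (p_ge0 : forall k, 0 <= p k) (p_sum1 : \sum_k p k = 1).
Hypothesis u_unit : forall k, p k != 0 -> qform 1%:M (u k) = 1.
Hypothesis u_le1 : forall k, qform 1%:M (u k) <= 1.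
Hypothesis u_isotropic : \sum_k p k *: (u k *m (u k)^T) = n%:R^-1%:M.

Definition dyad_sum l (f : {ffun 'I_l -> T}) : 'M[R]_n :=
  \sum_s u (f s) *m (u (f s))^T.

Lemma dyad_le x k : qform (u k *m (u k)^T) x <= qform 1%:M x.
Proof.
rewrite qform_outer.
have := bform_CauchySchwarz (u k) x (trmx1 _ _) (@qform1_ge0 R n).
rewrite {1}/bform mulmx1 => /le_trans; apply.
by rewrite ler_piMl // qform1_ge0.
Qed.

Lemma tr_dyad_sum l (f : {ffun 'I_l -> T}) : (dyad_sum f)^T = dyad_sum f.
Proof.
by rewrite /dyad_sum raddf_sum /=; apply: eq_bigr => s _; rewrite trmx_mul trmxK.
Qed.

Lemma dyad_sum_ge0 l (f : {ffun 'I_l -> T}) x : 0 <= qform (dyad_sum f) x.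
Proof. by rewrite qform_sum sumr_ge0 // => s _; rewrite qform_outer sqr_ge0. Qed.

Lemma dyad_sum_le l (f : {ffun 'I_l -> T}) x :
  qform (dyad_sum f) x <= l%:R * qform 1%:M x.
Proof.
have -> : l%:R = \sum_(s < l) (1 : R) by rewrite sumr_const card_ord.
rewrite qform_sum mulr_suml.
by apply: ler_sum => s _; rewrite mul1r dyad_le.
Qed.

(** This closes the recursion: the averaged moment of a matrix power is again its trace, up to the
    factor [1 / n]. *)
Lemma sum_qform_isotropic (M : 'M[R]_n) :
  \sum_k p k * qform M (u k) = \tr M / n%:R.
Proof.
transitivity (\tr (M *m \sum_k p k *: (u k *m (u k)^T))).
  rewrite mulmx_sumr raddf_sum /=; apply: eq_bigr => k _.
  by rewrite -scalemxAr mxtraceZ mxtrace_dyad.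
by rewrite u_isotropic -scalemx1 -scalemxAr mulmx1 mxtraceZ mulrC.
Qed.

Lemma qform_scalar a (x : 'cV[R]_n) : qform a%:M x = a * qform 1%:M x.
Proof. by rewrite -[a%:M]scalemx1 qformZ. Qed.

Lemma mxtrace_scalar_expr (a : R) N : \tr ((a%:M : 'M[R]_n) ^+ N) = n%:R * a ^+ N.
Proof.
have -> : (a%:M : 'M[R]_n) ^+ N = (a ^+ N)%:M.
  elim: N => [|N IH]; first by rewrite !expr0.
  by rewrite !exprS IH -[LHS]/(_ *m _) -scalar_mxM.
by rewrite mxtrace_scalar mulr_natl.
Qed.

Section Upper.
Variable c : R.
Hypothesis c_gt0 : 0 < c.

Lemma ge_id_upper l (f : {ffun 'I_l -> T}) : ge_id (1%:M + c *: dyad_sum f).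
Proof.
split; first by rewrite [LHS]linearD /= [(c *: _)^T]linearZ /= trmx1 tr_dyad_sum.
move=> x; rewrite qformD qformZ lerDl mulr_ge0 ?dyad_sum_ge0 //; exact: ltW.
Qed.

(** Averaging [trace_update_le] over one sample multiplies the potential by a constant; the initial
    value is the trace of the identity. *)
Lemma expect_trace_upper N l :
  prod_expect p (fun f : {ffun 'I_l -> T} => \tr ((1%:M + c *: dyad_sum f) ^+ N.+1))
  <= (1 + ((1 + c) ^+ N.+1 - 1) / n%:R) ^+ l * n%:R.
Proof.
have g0 : 0 <= (1 + c) ^+ N.+1 - 1 by rewrite subr_ge0 exprn_ege1 // lerDl ltW.
have := @prod_expect_sum_le _ _ p p_ge0 _ (fun k => u k *m (u k)^T)
  (fun Y => \tr ((1%:M + c *: Y) ^+ N.+1)) (1 + ((1 + c) ^+ N.+1 - 1) / n%:R) l.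
move=> /(_ _ _ l (leqnn l)); rewrite scaler0 addr0 mxtrace_scalar_expr expr1n mulr1.
apply; first by rewrite addr_ge0 // mulr_ge0 // invr_ge0 ler0n.
move=> j f _; rewrite -/(dyad_sum f) mulrDl mul1r mulrAC -mulrA -sum_qform_isotropic.
have avg x : x = \sum_k p k * x by rewrite -mulr_suml p_sum1 mul1r.
rewrite [X in X + _]avg mulr_sumr -big_split /=.
apply: ler_sum => k _; rewrite mulrCA -mulrDr.
have [->|pk] := eqVneq (p k) 0; first by rewrite !mul0r.
rewrite ler_wpM2l // scalerDr addrA.
exact: (trace_update_le (ge_id_upper f) (u_unit pk) c_gt0 N).
Qed.

Lemma trace_upper_ge l (f : {ffun 'I_l -> T}) v b N :
  0 <= b -> qform 1%:M v = 1 -> b <= qform (dyad_sum f) v ->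
  (1 + c * b) ^+ N.*2 <= \tr ((1%:M + c *: dyad_sum f) ^+ N.*2).
Proof.
move=> b0 v1 bv; have K1 := ge_id_upper f.
apply: le_trans (qform_le_trace _ _ v1); last by case: K1.
apply: le_trans (qform_expr_ge K1 v1 _).
have c0 := ltW c_gt0.
rewrite lerXn2r ?nnegrE ?qformD ?qformZ ?v1 ?addr_ge0 ?mulr_ge0 ?dyad_sum_ge0 //.
by rewrite lerD2l ler_wpM2l.
Qed.
End Upper.

Section Lower.
Variable c : R.
Hypothesis c_gt0 : 0 < c.

Lemma ge_id_lower beta (Y : 'M[R]_n) j : Y^T = Y ->
  (forall x, qform Y x <= j%:R * qform 1%:M x) -> 1 + c * j%:R <= beta ->
  ge_id (beta%:M - c *: Y).
Proof.
move=> YT Yj bj; split.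
  by rewrite [LHS]linearB /= [(c *: _)^T]linearZ /= tr_scalar_mx YT.
move=> x; rewrite qformD (qform_scalar beta) -scaleNr qformZ.
have := ler_wpM2r (qform1_ge0 x) bj; have := ler_wpM2l (ltW c_gt0) (Yj x).
lra.
Qed.

(** The choice of [beta] keeps the matrix above [I] through all [l] dyads, each at most [I]. The
    decrease in [trace_update_ge] has order one less than the potential; that order is odd, so
    [qform_expr_upper] raises it at the price of [beta]. *)
Lemma expect_trace_lower N l (w := (1 + c)^-1 ^+ N.+1.*2) (beta := 1 + c * l%:R) :
  prod_expect p (fun f : {ffun 'I_l -> T} =>
    \tr ((beta%:M - c *: dyad_sum f) ^+ N.+1.*2))
  <= (1 - (1 - w) / (n%:R * beta)) ^+ l * (n%:R * beta ^+ N.+1.*2).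
Proof.
have beta1 : 1 <= beta by rewrite lerDl mulr_ge0 // ltW.
have beta0 : 0 < beta by apply: lt_le_trans beta1.
have c1 : 0 < 1 + c by rewrite addr_gt0.
have n1 : 1 <= n%:R :> R by rewrite ler1n.
have n0 : 0 < n%:R :> R by rewrite ltr0n.
have w0 : 0 <= w by rewrite exprn_ge0 // invr_ge0 ltW.
have w1 : w <= 1 by rewrite exprn_ile1 ?invr_ge0 ?(ltW c1)// invf_le1 // lerDl ltW.
have := @prod_expect_sum_le _ _ p p_ge0 _ (fun k => u k *m (u k)^T)
  (fun Y => \tr ((beta%:M - c *: Y) ^+ N.+1.*2)) (1 - (1 - w) / (n%:R * beta)) l.
move=> /(_ _ _ l (leqnn l)); rewrite scaler0 subr0 mxtrace_scalar_expr.
apply.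
  rewrite subr_ge0 ler_pdivrMr ?mulr_gt0// mul1r.
  have : 1 <= n%:R * beta by rewrite mulr_ege1.
  lra.
move=> j f jl; rewrite -/(dyad_sum f).
set B := beta%:M - c *: dyad_sum f.
(* Adding a dyad to the sum subtracts it here, so the old matrix [B] is the rank-one update of the
   new one. *)
have BE k : B = (beta%:M - c *: (dyad_sum f + u k *m (u k)^T)) + c *: (u k *m (u k)^T).
  by rewrite scalerDr opprD addrA subrK.
have S1 k : ge_id (beta%:M - c *: (dyad_sum f + u k *m (u k)^T)).
  apply: (@ge_id_lower _ _ j.+1).
  - by rewrite [LHS]linearD /= tr_dyad_sum trmx_mul trmxK.
  - by move=> x; rewrite qformD -natr1 mulrDl mul1r lerD ?dyad_sum_le ?dyad_le.
  - by rewrite lerD2l ler_wpM2l ?(ltW c_gt0)// ler_nat.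
have B1 : ge_id B.
  apply: (@ge_id_lower _ _ j); first exact: tr_dyad_sum.
    exact: dyad_sum_le.
  by rewrite lerD2l ler_wpM2l ?(ltW c_gt0)// ler_nat ltnW.
have Bbeta x : qform B x <= beta * qform 1%:M x.
  rewrite /B qformD -scaleNr qformZ (qform_scalar beta) gerDl mulNr oppr_le0.
  by rewrite mulr_ge0 ?dyad_sum_ge0 ?(ltW c_gt0).
apply: le_trans (_ : \sum_k p k * (\tr (B ^+ N.+1.*2)
   - (1 - w) / beta * qform (B ^+ N.+1.*2) (u k)) <= _); last first.
  under eq_bigr do rewrite mulrBr mulrCA.
  rewrite sumrB -mulr_suml p_sum1 mul1r -mulr_sumr sum_qform_isotropic.
  rewrite le_eqVlt; apply/orP; left; apply/eqP.
  by field; rewrite !lt0r_neq0.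
apply: ler_sum => k _.
have [->|pk] := eqVneq (p k) 0; first by rewrite !mul0r.
rewrite ler_wpM2l // -[_.+1.*2]/(N.*2.+1.+1).
apply: le_trans (trace_update_ge (S1 k) (u_unit pk) c_gt0 _) _.
rewrite -BE lerD2l lerN2 -mulrA ler_wpM2l ?subr_ge0 //.
rewrite ler_pdivrMl //; exact: (qform_expr_upper B1 (u_unit pk) N Bbeta).
Qed.

Lemma trace_lower_ge l (f : {ffun 'I_l -> T}) v a N (beta := 1 + c * l%:R) :
  a <= l%:R -> qform 1%:M v = 1 -> qform (dyad_sum f) v <= a ->
  (beta - c * a) ^+ N.*2 <= \tr ((beta%:M - c *: dyad_sum f) ^+ N.*2).
Proof.
move=> al v1 va.
have K1 : ge_id (beta%:M - c *: dyad_sum f).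
  by apply: (@ge_id_lower _ _ l) => //; [exact: tr_dyad_sum | exact: dyad_sum_le].
apply: le_trans (qform_le_trace _ _ v1); last by case: K1.
apply: le_trans (qform_expr_ge K1 v1 _).
have ba : 0 <= beta - c * a.
  by rewrite /beta -addrA -mulrBr addr_ge0 // mulr_ge0 ?subr_ge0 // ltW.
have E : beta - c * a <= qform (beta%:M - c *: dyad_sum f) v.
  by rewrite qformD -scaleNr qformZ (qform_scalar beta) v1 mulr1 mulNr lerD2l lerN2 ler_pM2l.
by rewrite lerXn2r ?nnegrE // (le_trans ba E).
Qed.
End Lower.
End IsotropicDyads.

(** * From the leverage-score sketch to the condition number *)

Section LeverageSketch.
Variables (R : realType) (m n : nat) (Q : 'M[R]_(m, n)).
Hypothesis Q_orth : Q^T *m Q = 1%:M.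

(** A zero row yields the zero vector, as [0^-1 = 0]; its index has probability 0. *)
Definition unit_row (k : 'I_m) : 'cV[R]_n := (rownorm2 Q k)^-1 *: (row k Q)^T.

Lemma rownorm2_sqr k : rownorm2 Q k ^+ 2 = qform 1%:M (row k Q)^T.
Proof.
rewrite sqr_sqrtr; last by rewrite sumr_ge0 // => j _; rewrite sqr_ge0.
by rewrite qform1E; apply: eq_bigr => j _; rewrite !mxE.
Qed.

Lemma rownorm2_eq0 k : rownorm2 Q k = 0 -> row k Q = 0.
Proof.
move=> k0; have := rownorm2_sqr k; rewrite k0 expr0n qform1E => /esym/eqP.
rewrite psumr_eq0 => [/allP /= H|j _]; last by rewrite sqr_ge0.
apply/rowP => j; rewrite !mxE; apply/eqP.
by have := H j (mem_index_enum _); rewrite !mxE sqrf_eq0.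
Qed.

Lemma unit_row_qform k : rownorm2 Q k != 0 -> qform 1%:M (unit_row k) = 1.
Proof. by move=> k0; rewrite qform1Z -rownorm2_sqr -exprMn mulVf // expr1n. Qed.

Lemma lev_prob_ge0 k : 0 <= lev_prob Q k.
Proof. by rewrite divr_ge0 ?sqr_ge0 ?ler0n. Qed.

Lemma unit_row_unit k : lev_prob Q k != 0 -> qform 1%:M (unit_row k) = 1.
Proof.
move=> pk; apply: unit_row_qform; apply: contraNneq pk => k0.
by rewrite /lev_prob k0 expr0n mul0r.
Qed.

Lemma unit_row_le1 k : qform 1%:M (unit_row k) <= 1.
Proof.
have [k0|/unit_row_qform->//] := eqVneq (rownorm2 Q k) 0.
by rewrite qform1Z k0 invr0 expr0n mul0r.
Qed.

(** The sampling weight cancels the normalisation up to [1 / n], leaving [Q^T *m Q]; zero rows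
    contribute nothing to either side. *)
Lemma unit_row_isotropic :
  \sum_k lev_prob Q k *: (unit_row k *m (unit_row k)^T) = n%:R^-1%:M.
Proof.
transitivity (n%:R^-1 *: (Q^T *m Q)); last by rewrite Q_orth scalemx1.
apply/matrixP => i j; rewrite summxE !mxE mulr_sumr; apply: eq_bigr => k _.
rewrite !mxE big_ord1 !mxE /lev_prob.
have [k0|k0] := eqVneq (rownorm2 Q k) 0.
  have := congr1 (fun v : 'rV_n => v 0 i) (rownorm2_eq0 k0); rewrite !mxE => ->.
  by rewrite k0 expr0n !mul0r mulr0.
by move: (n%:R^-1) => w; field.
Qed.

Lemma lev_prob_sum1 : (0 < n)%N -> \sum_k lev_prob Q k = 1.
Proof.
move=> n0; have : \tr (Q^T *m Q) = n%:R by rewrite Q_orth mxtrace1.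
rewrite mxtrace_mulC => trQ.
rewrite -mulr_suml (_ : \sum_i _ = n%:R) ?divff ?pnatr_eq0 -?lt0n// -trQ.
apply: eq_bigr => k _; rewrite rownorm2_sqr qform1E mxE.
by apply: eq_bigr => j _; rewrite !mxE expr2.
Qed.

Variable l : nat.
Implicit Type idx : {ffun 'I_l -> 'I_m}.

Lemma dyad_sum_sketch idx :
  dyad_sum unit_row idx = (sketch Q Q idx)^T *m sketch Q Q idx.
Proof.
apply/matrixP => i j; rewrite summxE mxE; apply: eq_bigr => s _.
by rewrite !mxE big_ord1 !mxE.
Qed.

Lemma sketch_mul (Rf : 'M[R]_n) idx :
  sketch (Q *m Rf) Q idx = sketch Q Q idx *m Rf.
Proof.
apply/matrixP => s j; rewrite !mxE mulr_sumr.
by apply: eq_bigr => k _; rewrite !mxE mulrA.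
Qed.

Lemma vnorm2E k (v : 'cV[R]_k) : vnorm2 v = Num.sqrt (qform 1%:M v).
Proof. by rewrite qform1E. Qed.

Lemma qform_gram k (Z : 'M[R]_(k, n)) v : qform (Z^T *m Z) v = qform 1%:M (Z *m v).
Proof. by rewrite /qform /bform trmx_mul mulmx1 !mulmxA. Qed.

Lemma qform1_eq0 k (v : 'cV[R]_k) : qform 1%:M v = 0 -> v = 0.
Proof.
rewrite qform1E => /eqP; rewrite psumr_eq0 => [/allP /= H|j _]; last by rewrite sqr_ge0.
apply/colP => j; rewrite mxE; apply/eqP.
by have := H j (mem_index_enum _); rewrite sqrf_eq0.
Qed.

Lemma qform1_normalize k (v : 'cV[R]_k) :
  v != 0 -> qform 1%:M ((Num.sqrt (qform 1%:M v))^-1 *: v) = 1.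
Proof.
move=> v0; rewrite qform1Z exprVn sqr_sqrtr ?qform1_ge0// mulVf //.
by apply: contra_neq v0; exact: qform1_eq0.
Qed.

Lemma qformZr k a (M : 'M[R]_k) v : qform M (a *: v) = a ^+ 2 * qform M v.
Proof.
by rewrite /qform /bform [(a *: v)^T]linearZ /= -!scalemxAl -scalemxAr scalerA mxE.
Qed.

Lemma exists_unit_vector : (0 < n)%N -> exists v : 'cV[R]_n, vnorm2 v = 1.
Proof.
case: n => // k _; exists (delta_mx 0 0).
rewrite vnorm2E qform1E (bigD1 0) //= big1 => [|i i0]; rewrite !mxE ?eqxx.
  by rewrite addr0 expr1n sqrtr1.
by rewrite (negPf i0) expr0n.
Qed.

Lemma vnorm2_eq1 k (v : 'cV[R]_k) : vnorm2 v = 1 -> qform 1%:M v = 1.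
Proof. by rewrite vnorm2E => v1; rewrite -(sqr_sqrtr (qform1_ge0 v)) v1 expr1n. Qed.

Lemma qform0r k (M : 'M[R]_k) : qform M 0 = 0.
Proof. by rewrite -(scale0r 0) qformZr expr0n mul0r. Qed.

Lemma sigma_bounds k (X : 'M[R]_(k, n)) s t : (0 < n)%N ->
  (forall v, vnorm2 v = 1 -> s <= vnorm2 (X *m v) <= t) ->
  s <= sigma_min X /\ sigma_max X <= t.
Proof.
move=> n_gt0 st; have [v1 v1E] := exists_unit_vector n_gt0.
split.
  apply: lb_le_inf; first by exists (vnorm2 (X *m v1)); exists v1.
  by move=> _ [v /st /andP[sv _] <-].
apply: ge_sup; first by exists (vnorm2 (X *m v1)); exists v1.
by move=> _ [v /st /andP[_ vt] <-].
Qed.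

(* If no reduced QR decomposition existed, [qr_R] would be the junk value 0 and
   [cond_X] would be 0: the bound holds without proving that one exists. *)
Lemma cond_X_le (Rf : 'M[R]_n) idx a b : (0 < n)%N ->
  \rank (Q *m Rf) = n -> 0 < a -> 0 < b ->
  (forall v, qform 1%:M v = 1 -> a < qform (dyad_sum unit_row idx) v < b) ->
  (cond_X (Q *m Rf) Q idx <= (Num.sqrt (b / a))%:E)%E.
Proof.
move=> n_gt0 rkA a0 b0 ab; rewrite /cond_X sketch_mul.
set Z := sketch Q Q idx.
(* Rescaling extends the bounds from unit vectors to all [v], with the dyad sum read as the Gram
   matrix of [Z]. *)
have {}ab v : a * qform 1%:M v <= qform 1%:M (Z *m v) <= b * qform 1%:M v.
  have [->|v0] := eqVneq v 0; first by rewrite mulmx0 !qform0r !mulr0 lexx.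
  have qv : 0 < qform 1%:M v.
    by rewrite lt_def qform1_ge0 andbT; apply: contra_neq v0; exact: qform1_eq0.
  have := ab _ (qform1_normalize v0).
  rewrite dyad_sum_sketch qformZr qform_gram exprVn sqr_sqrtr ?qform1_ge0//.
  by rewrite -/Z mulrC ltr_pdivlMr // ltr_pdivrMr // => /andP[/ltW -> /ltW ->].
have Rf_unit : Rf \in unitmx.
  rewrite -row_free_unit /row_free eqn_leq rank_leq_row -{1}rkA; exact: mxrankM_maxr.
have rkZ : \rank (Z *m Rf) = n.
  rewrite mxrankMfree ?row_free_unit//.
  apply/eqP; rewrite -mxrank_tr -/(row_free _) -kermx_eq0; apply/eqP.
  apply/row_matrixP => i; rewrite row0.
  have kerZ : Z *m (row i (kermx Z^T))^T = 0.
    by rewrite -{1}[Z]trmxK -trmx_mul -row_mul mulmx_ker row0 trmx0.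
  have /andP[] := ab (row i (kermx Z^T))^T; rewrite kerZ qform0r.
  rewrite pmulr_rle0 // => le0 _; apply: trmx_inj; rewrite trmx0.
  by apply: qform1_eq0; apply/eqP; rewrite eq_le le0 qform1_ge0.
rewrite rkZ eqxx lee_fin.
set R1 := qr_R (Z *m Rf); set X := Q *m Rf *m invmx R1.
have [[R2 [Q2 QR2]]|noR] := pselect (exists R2 Q2, is_reduced_QR (Z *m Rf) Q2 R2); last first.
  (* Here [R1] is the default 0, and [invmx] returns a singular matrix unchanged. *)
  have X0 : X = 0.
    rewrite /X /R1 /qr_R xgetPN; last by move=> R2 [Q2 QR2]; apply: noR; exists R2, Q2.
    by rewrite /invmx -row_free_unit /row_free mxrank0 (ltn_eqF n_gt0) mulmx0.
  have [smin smax] : 0 <= sigma_min X /\ sigma_max X <= 0.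
    by apply: sigma_bounds => // v _; rewrite X0 mul0mx vnorm2E qform0r sqrtr0 lexx.
  by apply: le_trans (sqrtr_ge0 _); rewrite mulr_le0_ge0 // invr_ge0.
have [Q1 [QRE Q1orth _ _]] : exists Q1, is_reduced_QR (Z *m Rf) Q1 R1.
  have : exists R2, [set R2 | exists Q1, is_reduced_QR (Z *m Rf) Q1 R2]%classic R2.
    by exists R2, Q2.
  by move=> /(xgetPex (0 : 'M[R]_n)).
have R1unit : R1 \in unitmx.
  rewrite -row_free_unit /row_free eqn_leq rank_leq_row -{1}rkZ QRE; exact: mxrankM_maxr.
(* For [w = Rf *m invmx R1 *m v], the vector [X *m v = Q *m w] has the norm of [w], while
   [Z *m w = Q1 *m v] has norm 1; hence [a |w|^2 <= 1 <= b |w|^2]. *)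
have Xb v : vnorm2 v = 1 -> (Num.sqrt b)^-1 <= vnorm2 (X *m v) <= (Num.sqrt a)^-1.
  move=> /vnorm2_eq1 v1; pose w := Rf *m invmx R1 *m v.
  have XvE : vnorm2 (X *m v) = Num.sqrt (qform 1%:M w).
    have -> : X *m v = Q *m w by rewrite /X /w !mulmxA.
    by rewrite vnorm2E -qform_gram Q_orth.
  have Zw : qform 1%:M (Z *m w) = 1.
    have -> : Z *m w = Q1 *m v by rewrite /w !mulmxA QRE mulmxK.
    by rewrite -qform_gram Q1orth.
  have := ab w; rewrite Zw XvE -!sqrtrV ?(ltW a0) ?(ltW b0)// => /andP[lo hi].
  apply/andP; split; apply: ler_wsqrtr.
    by rewrite -[b^-1]mul1r ler_pdivrMr // mulrC.
  by rewrite -[a^-1]mul1r ler_pdivlMr // mulrC.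
have [smin smax] := sigma_bounds n_gt0 Xb.
have sb : 0 < (Num.sqrt b)^-1 by rewrite invr_gt0 sqrtr_gt0.
rewrite ler_pdivrMr; last exact: lt_le_trans smin.
apply: le_trans smax _.
apply: le_trans (_ : Num.sqrt (b / a) * (Num.sqrt b)^-1 <= _); last by rewrite ler_wpM2l.
rewrite sqrtrM ?(ltW b0)// sqrtrV ?(ltW a0)// mulrAC divff ?mul1r //.
by rewrite lt0r_neq0 // sqrtr_gt0.
Qed.

End LeverageSketch.

(** * Exponential bounds for the scalar factors *)

Section ScalarBounds.
Variable R : realType.
Implicit Types x c b a d : R.

(** Invert [1 + y <= expR y] at [y = - x / (1 + x)]. *)
Lemma expR_le1Dx x : 0 <= x -> expR (x / (1 + x)) <= 1 + x.
Proof.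
move=> x0; have x1 : 0 < 1 + x by rewrite ltr_wpDr.
rewrite -lef_pV2 ?posrE ?expR_gt0// -expRN.
apply: le_trans (expR_ge1Dx _).
by rewrite le_eqVlt; apply/orP; left; apply/eqP; field; rewrite lt0r_neq0.
Qed.

(** Since [M * c = theta], the numerator is bounded through [1 + y <= expR y] and the denominator
    through [expR_le1Dx]; the latter leaves the correction [1 + c * b], which tends to 1 as [M]
    grows. *)
Lemma upper_tail_bound (n l M : nat) (theta b : R) (c := theta / M%:R) :
  (0 < n)%N -> (0 < M)%N -> 0 < theta -> 0 <= b ->
  (1 + ((1 + c) ^+ M - 1) / n%:R) ^+ l * n%:R / (1 + c * b) ^+ M
  <= n%:R * expR ((expR theta - 1) * (l%:R / n%:R) - theta * b / (1 + c * b)).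
Proof.
move=> n0 M0 th0 b0.
have nR : 0 < n%:R :> R by rewrite ltr0n.
have MR : 0 < M%:R :> R by rewrite ltr0n.
have c0 : 0 < c by rewrite divr_gt0.
have cb : 0 <= c * b by rewrite mulr_ge0 // ltW.
have MC : M%:R * c = theta by rewrite /c mulrC divfK // lt0r_neq0.
have g0 : 0 <= 1 + ((1 + c) ^+ M - 1) / n%:R.
  by rewrite addr_ge0 // divr_ge0 ?(ltW nR)// subr_ge0 exprn_ege1 // lerDl ltW.
rewrite expRD expRN mulrA ler_pM //.
- by rewrite mulr_ge0 ?(ltW nR)// exprn_ge0.
- by rewrite invr_ge0 exprn_ge0 // addr_ge0.
- rewrite mulrC ler_pM2l // mulrCA expRM_natl lerXn2r ?nnegrE ?expR_ge0//.
  apply: le_trans (expR_ge1Dx _); rewrite lerD2l ler_pM2r ?invr_gt0// lerD2r.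
  rewrite -MC expRM_natl lerXn2r ?nnegrE ?expR_ge0 ?addr_ge0 ?(ltW c0)//.
  exact: expR_ge1Dx.
rewrite lef_pV2 ?posrE ?expR_gt0 ?exprn_gt0 ?ltr_wpDr//.
have -> : theta * b / (1 + c * b) = M%:R * (c * b / (1 + c * b)) by rewrite -MC !mulrA.
by rewrite expRM_natl lerXn2r ?nnegrE ?expR_ge0 ?addr_ge0 // expR_le1Dx.
Qed.

Lemma lower_tail_bound (n l M : nat) (tau a : R) (d := tau / M%:R)
    (beta := 1 + d * l%:R) :
  (0 < n)%N -> (0 < M)%N -> 0 < tau -> 0 <= a <= l%:R ->
  (1 - (1 - (1 + d)^-1 ^+ M) / (n%:R * beta)) ^+ l * (n%:R * beta ^+ M)
    / (beta - d * a) ^+ M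
  <= n%:R * expR (tau * a - (1 - expR (- (tau / (1 + d)))) / beta * (l%:R / n%:R)).
Proof.
move=> n0 M0 tau0 /andP[a0 al].
have nR : 0 < n%:R :> R by rewrite ltr0n.
have n1 : 1 <= n%:R :> R by rewrite ler1n.
have MR : 0 < M%:R :> R by rewrite ltr0n.
have d0 : 0 < d by rewrite divr_gt0.
have d1 : 0 < 1 + d by rewrite addr_gt0.
have beta1 : 1 <= beta by rewrite lerDl mulr_ge0 // ltW.
have beta0 : 0 < beta by apply: lt_le_trans beta1.
have MD : M%:R * d = tau by rewrite /d mulrC divfK // lt0r_neq0.
have bda1 : 1 <= beta - d * a.
  by rewrite /beta -addrA -mulrBr lerDl mulr_ge0 ?subr_ge0 // ltW.
have bda0 : 0 < beta - d * a by apply: lt_le_trans bda1.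
have w_le : (1 + d)^-1 ^+ M <= expR (- (tau / (1 + d))).
  rewrite exprVn expRN lef_pV2 ?posrE ?expR_gt0 ?exprn_gt0//.
  rewrite -MD -mulrA expRM_natl lerXn2r ?nnegrE ?expR_ge0 ?(ltW d1)//.
  exact: expR_le1Dx (ltW d0).
have w0 : 0 <= (1 + d)^-1 ^+ M by rewrite exprn_ge0 // invr_ge0 ltW.
set w := (1 + d)^-1 ^+ M in w_le w0 *.
have r0 : 0 <= 1 - (1 - w) / (n%:R * beta).
  rewrite subr_ge0 ler_pdivrMr ?mulr_gt0// mul1r.
  have : 1 <= n%:R * beta by rewrite mulr_ege1.
  lra.
have step1 : (1 - (1 - w) / (n%:R * beta)) ^+ l
    <= expR (- ((1 - expR (- (tau / (1 + d)))) / beta * (l%:R / n%:R))).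
  set z := expR (- (tau / (1 + d))) in w_le *.
  have -> : - ((1 - z) / beta * (l%:R / n%:R)) = l%:R * - ((1 - z) / (n%:R * beta)).
    by field; rewrite !lt0r_neq0.
  rewrite expRM_natl lerXn2r ?nnegrE ?expR_ge0//.
  apply: le_trans (expR_ge1Dx _); rewrite lerD2l lerN2 ler_pM2r ?invr_gt0 ?mulr_gt0//.
  by rewrite lerD2l lerN2.
(* As [beta - d * a >= 1], the quotient is at most [1 + d * a]. *)
have step2 : (beta / (beta - d * a)) ^+ M <= expR (tau * a).
  rewrite -MD -mulrA expRM_natl lerXn2r ?nnegrE ?expR_ge0 ?divr_ge0 ?(ltW beta0) ?(ltW bda0)//.
  apply: le_trans (expR_ge1Dx _); rewrite ler_pdivrMr // mulrDl mul1r mulrBr.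
  have : d * a <= d * a * (beta - d * a) by rewrite ler_peMr // mulr_ge0 // ltW.
  lra.
have -> : (1 - (1 - w) / (n%:R * beta)) ^+ l * (n%:R * beta ^+ M) / (beta - d * a) ^+ M
  = n%:R * ((1 - (1 - w) / (n%:R * beta)) ^+ l * (beta / (beta - d * a)) ^+ M).
  by rewrite expr_div_n; ring.
rewrite ler_pM2l // [X in expR X]addrC expRD ler_pM ?exprn_ge0 //.
by rewrite divr_ge0 // ltW.
Qed.

End ScalarBounds.

Import numFieldNormedType.Exports.

(** * Letting the exponent tend to infinity *)

Section Limit.
Local Open Scope classical_set_scope.
Variable R : realType.

Lemma cvg_inv_double : ((N.+1.*2)%:R^-1 : R) @[N --> \oo] --> (0 : R).
Proof.
have : (harmonic N * 2^-1 : R) @[N --> \oo] --> (0 * 2^-1 : R).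
  by apply: cvgM; [exact: cvg_harmonic | exact: cvg_cst].
rewrite mul0r; apply: cvg_trans; apply: near_eq_cvg; near=> N.
by rewrite /harmonic -muln2 natrM invfM.
Unshelve. all: by end_near.
Qed.

(** The variable [e] stands for [1 / M]: the coefficients are [theta * e] and [tau * e], and the
    upper threshold is lowered by [e]. *)
Lemma cvg_tail_bounds (n L theta b delta tau a l : R) :
  n * expR (delta * L - theta * (b - e) / (1 + theta * e * (b - e)))
  + n * expR (tau * a - (1 - expR (- (tau / (1 + tau * e)))) / (1 + tau * e * l) * L)
  @[e --> (0 : R)] -->
  n * expR (delta * L - theta * b) + n * expR (tau * a - (1 - expR (- tau)) * L).
Proof.
have id0 : (e : R) @[e --> (0 : R)] --> (0 : R) by exact: cvg_id.
have ce (k : R) : (k * e) @[e --> (0 : R)] --> (0 : R).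
  by rewrite -[X in _ --> X](mulr0 k); apply: cvgM => //; exact: cvg_cst.
have ke1 (f : R -> R) (v : R) : f e @[e --> (0 : R)] --> v ->
    forall k, (1 + k * e * f e)^-1 @[e --> (0 : R)] --> (1 : R).
  move=> fv k; rewrite -[X in _ --> X]invr1; apply: cvgV; first exact: oner_neq0.
  rewrite -[X in _ --> X]addr0 -[X in _ --> _ + X](mul0r v).
  by apply: cvgD; [exact: cvg_cst|apply: cvgM].
have expc (f : R -> R) (v : R) : f e @[e --> (0 : R)] --> v ->
    expR (f e) @[e --> (0 : R)] --> expR v.
  by move=> fv; apply: (continuous_cvg _ _ fv); exact: continuous_expR.
have be : (b - e) @[e --> (0 : R)] --> b.
  by rewrite -[X in _ --> X]subr0; apply: cvgB => //; exact: cvg_cst.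
apply: cvgD; apply: cvgM; first exact: cvg_cst.
- apply: (expc); apply: cvgB; first exact: cvg_cst.
  rewrite -[X in _ --> X]mulr1; apply: cvgM; last exact: ke1 be _.
  by apply: cvgM => //; exact: cvg_cst.
- exact: cvg_cst.
apply: (expc); apply: cvgB; first exact: cvg_cst.
apply: cvgM; last exact: cvg_cst.
rewrite -[X in _ --> X]mulr1; apply: cvgM; last first.
  by apply: (ke1 (fun=> l)); exact: cvg_cst.
apply: cvgB; first exact: cvg_cst.
apply: (expc); apply: cvgN; rewrite -[X in _ --> X]mulr1; apply: cvgM; first exact: cvg_cst.
have -> : (fun e => (1 + tau * e)^-1) = (fun e => (1 + tau * e * 1)^-1).
  by apply/funext => e; rewrite mulr1.
by apply: (ke1 (fun=> 1)); exact: cvg_cst.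
Qed.

End Limit.

(** * Markov's inequality and choice of the parameters *)

(* The inequality [b < t * a] is strict, so that the supremum and the infimum in
   [cond_X] need not be attained. *)
Lemma prob_cond_markov (R : realType) (m n l : nat) (Q : 'M[R]_(m, n)) (Rf : 'M[R]_n)
    (a b c d t : R) (N : nat) (M := N.+1.*2) (beta := 1 + d * l%:R) :
  (0 < n)%N -> \rank (Q *m Rf) = n -> Q^T *m Q = 1%:M ->
  0 < c -> 0 < d -> 0 < a <= l%:R -> 0 < b -> b < t * a ->
  @prob_idx R m n l Q (fun idx => (cond_X (Q *m Rf) Q idx >= (Num.sqrt t)%:E)%E)
  <= (1 + ((1 + c) ^+ M - 1) / n%:R) ^+ l * n%:R / (1 + c * b) ^+ M
   + (1 - (1 - (1 + d)^-1 ^+ M) / (n%:R * beta)) ^+ l * (n%:R * beta ^+ M)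
     / (beta - d * a) ^+ M.
Proof.
move=> n0 rkA Qorth c0 d0 /andP[a0 al] b0 bta.
set u := unit_row Q; set p := lev_prob Q.
pose U (f : {ffun 'I_l -> 'I_m}) := \tr ((1%:M + c *: dyad_sum u f) ^+ M).
pose L (f : {ffun 'I_l -> 'I_m}) := \tr ((beta%:M - d *: dyad_sum u f) ^+ M).
have [v1 /vnorm2_eq1 v1E] := exists_unit_vector R n0.
have u1 := @unit_row_le1 R m n Q.
have p0 := @lev_prob_ge0 R m n Q.
(* Both potentials are at least 1, by the pointwise bounds at the trivial thresholds [0] and [l]. *)
have U0 f : 0 <= U f.
  apply: le_trans (trace_upper_ge c0 N.+1 (lexx 0) v1E (dyad_sum_ge0 u f v1)).
  by rewrite mulr0 addr0 expr1n.
have L0 f : 0 <= L f.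
  have := dyad_sum_le u1 f v1; rewrite v1E mulr1 => dl.
  apply: le_trans (trace_lower_ge u1 d0 N.+1 (lexx _) v1E dl).
  by rewrite addrK expr1n.
have cb : 0 < (1 + c * b) ^+ M by rewrite exprn_gt0 // addr_gt0 // mulr_gt0.
have da : 0 < (beta - d * a) ^+ M.
  rewrite exprn_gt0 // /beta -addrA -mulrBr ltr_wpDr // mulr_ge0 ?subr_ge0 //; exact: ltW.
(* On the bad event one normalised potential is at least 1, so their sum dominates the indicator:
   union bound and Markov's inequality at once. *)
have badE f : ((Num.sqrt t)%:E <= cond_X (Q *m Rf) Q f)%E ->
    1 <= U f / (1 + c * b) ^+ M + L f / (beta - d * a) ^+ M.
  move=> condf.
  have [v [v1' vbad]] : exists v, qform 1%:M v = 1 /\ ~~ (a < qform (dyad_sum u f) v < b).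
    apply: contrapT => nov.
    have := cond_X_le Qorth n0 rkA a0 b0 (idx := f).
    have good v : qform 1%:M v = 1 -> a < qform (dyad_sum u f) v < b.
      by move=> v1'; apply: contraT => vbad; exfalso; apply: nov; exists v.
    move=> /(_ good) /(le_trans condf); rewrite lee_fin leNgt => /negP; apply.
    by rewrite ltr_sqrt ?ltr_pdivrMr // -(pmulr_lgt0 _ a0) (lt_trans b0).
  move: vbad; rewrite negb_and -!leNgt => /orP[va|vb].
    rewrite -[leLHS]add0r lerD //; first by rewrite divr_ge0 // ltW.
    by rewrite ler_pdivlMr // mul1r; exact: (trace_lower_ge u1 d0 N.+1 al v1' va).
  rewrite -[leLHS]addr0 lerD //; last by rewrite divr_ge0 // ltW.
  by rewrite ler_pdivlMr // mul1r; exact: (trace_upper_ge c0 N.+1 (ltW b0) v1' vb).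
apply: le_trans (_ : prod_expect p U / (1 + c * b) ^+ M
  + prod_expect p L / (beta - d * a) ^+ M <= _).
  rewrite -!prod_expectZ /prod_expect -big_split /= /prob_idx big_mkcond /=.
  apply: ler_sum => f _; rewrite -mulrDr.
  have pf : 0 <= \prod_(s < l) p (f s) by rewrite prodr_ge0.
  case: asboolP => [/badE H|_]; first by rewrite ler_peMr.
  by rewrite mulr_ge0 // addr_ge0 // divr_ge0 // ltW.
rewrite lerD // ler_pM2r ?invr_gt0 //.
  apply: expect_trace_upper => //; first exact: lev_prob_sum1.
    exact: unit_row_unit.
  exact: unit_row_isotropic.
apply: expect_trace_lower => //; first exact: lev_prob_sum1.
  exact: unit_row_unit.
exact: unit_row_isotropic.
Qed.

Theorem theorem3p4 (R : realType) (m n l : nat) (A Q : 'M[R]_(m, n)) (Rf : 'M[R]_n)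
  (hn : (0 < n)%N) (hmn : (n <= m)%N) (hln : (n <= l)%N)
  (hrank : \rank A = n) (hQR : A = Q *m Rf) (hQ : Q^T *m Q = 1%:M)
  (hR : upper_triangular Rf)
  (delta eps : R) (hdelta : 0 < delta) (heps0 : 0 < eps) (heps1 : eps < 1) :
  @prob_idx R m n l Q (fun idx => (cond_X A Q idx >= (Num.sqrt ((1 + delta) / (1 - eps)))%:E)%E)
  <= n%:R * ((expR (- eps) / powR (1 - eps) (1 - eps)) `^ (l%:R / n%:R)
             + (expR delta / powR (1 + delta) (1 + delta)) `^ (l%:R / n%:R)).
Proof.
have n0 : 0 < n%:R :> R by rewrite ltr0n.
have l0 : 0 < l%:R :> R by rewrite ltr0n (leq_trans hn).
set L : R := l%:R / n%:R.
have L1 : 1 <= L by rewrite ler_pdivlMr // mul1r ler_nat.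
have L0 : 0 < L by apply: lt_le_trans L1.
have Ll : L <= l%:R by rewrite ler_pdivrMr // ler_peMr ?ler1n // ltW.
have e0 : 0 < 1 - eps by rewrite subr_gt0.
have d0 : 0 < 1 + delta by rewrite addr_gt0.
(* The minimisers of the limiting exponents [(expR theta - 1) * L - theta * b] and
   [tau * a - (1 - expR (- tau)) * L], with [a], [b] as below. *)
pose theta := ln (1 + delta); pose tau := - ln (1 - eps).
have theta0 : 0 < theta by rewrite ln_gt0 // ltrDl.
have tau0 : 0 < tau by rewrite oppr_gt0 ln_lt0 // e0 gtrDl oppr_lt0.
have expt : expR theta = 1 + delta by rewrite lnK.
have expu : expR (- tau) = 1 - eps by rewrite opprK lnK.
have tailE (x y : R) : 0 < y -> (expR x / powR y y) `^ L = expR (x * L - ln y * (y * L)).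
  move=> y0; rewrite {2}/powR (gt_eqF y0) -expRB -expRM; congr expR; ring.
rewrite !tailE // mulrDr [leRHS]addrC.
(* The expected Gram matrix is [L] times the identity; these thresholds have exactly the required
   ratio. *)
pose a := (1 - eps) * L; pose b := (1 + delta) * L.
have ta : (1 + delta) / (1 - eps) * a = b.
  by rewrite /a /b mulrA divfK // lt0r_neq0.
have := cvg_comp _ _ (@cvg_inv_double R)
  (@cvg_tail_bounds R n%:R L theta b delta tau a l%:R).
rewrite expu [1 - (1 - eps)]subKr.
have -> : tau * a - eps * L = - eps * L - ln (1 - eps) * ((1 - eps) * L).
  by rewrite /tau /a; ring.
move=> tail_cvg.
(* The probability does not depend on [N], so it suffices to bound it for each [M], with [b] lowered
   by [1 / M] to make the ratio of thresholds strictly smaller. *)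
apply: (ler_cvg_to (cvg_cst _) tail_cvg); apply: nearW => N /=.
set M := N.+1.*2; have M0 : 0 < M%:R :> R by rewrite ltr0n.
(* The lowered threshold stays positive because [L >= 1], which is where [n <= l] enters. *)
have Mb : M%:R^-1 < b.
  apply: le_lt_trans (_ : 1 < b); first by rewrite invf_le1 // ler1n.
  by rewrite /b (lt_le_trans (_ : 1 < 1 + delta)) ?ltrDl // ler_peMr // ltW.
have a0 : 0 < a by rewrite mulr_gt0.
have al : a <= l%:R by apply: le_trans Ll; rewrite ler_piMl ?(ltW L0)// gerBl ltW.
rewrite hQR; apply: le_trans (@prob_cond_markov R m n l Q Rf a (b - M%:R^-1)
  (theta / M%:R) (tau / M%:R) _ N hn _ hQ _ _ _ _ _) _; rewrite -?hQR //.
- by rewrite divr_gt0.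
- by rewrite divr_gt0.
- by rewrite a0.
- by rewrite subr_gt0.
- by rewrite ta gtrDl oppr_lt0 invr_gt0.
apply: lerD.
  have := @upper_tail_bound R n l M theta (b - M%:R^-1) hn isT theta0.
  by rewrite expt addrAC subrr add0r; apply; rewrite subr_ge0 ltW.
by apply: lower_tail_bound; rewrite // (ltW a0).
Qed.
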